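(* For every directed temporal graph $\mathcal{G}=(V,E,\lambda)$, considered with non-strict temporal paths, there exists a proper directed temporal graph $\mathcal{H}$ on the same vertex set $V$ with $\mathcal{R}(\mathcal{G})=\mathcal{R}(\mathcal{H})$. In other words, every graph in the setting D \& non-strict has a reachability equivalent graph in the setting D \& proper.
   Context: A directed temporal graph is a triple $\mathcal{G}=(V,E,\lambda)$ with $V$ a finite vertex set, $E\subseteq\{(u,v)\in V\times V: u\ne v\}$ a set of arcs, and $\lambda$ assigns to each arc a nonempty finite set of time labels. $\mathcal{G}$ is proper if no two distinct arcs incident to a common vertex share a time label. A temporal path from $u$ to $v$ is a sequence $(e_1,t_1),\dots,(e_k,t_k)$, $k\ge1$, with $t_i\in\lambda(e_i)$, such that $e_1,\dots,e_k$ form a directed path from $u$ to $v$ (distinct vertices) and $t_1\le\dots\le t_k$. The reachability graph $\mathcal{R}(\mathcal{G})$ is the static directed graph on $V$ with an arc $(u,v)$, $u\ne v$, iff there is a temporal path from $u$ to $v$. *)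

(* Defs.v *)
From mathcomp Require Import all_boot.
From mathcomp Require Import finmap boolp.

Set Implicit Arguments.
Unset Strict Implicit.
Unset Printing Implicit Defensive.

(* The values of labels outside arcs are irrelevant: every notion below
   consults labels e only when e \in arcs. *)
Record temporal_digraph (V : finType) := TemporalDigraph {
  arcs : {set V * V};
  labels : V * V -> {fset nat};
  arcs_loopless : forall u v, (u, v) \in arcs -> u != v;
  labels_nonempty : forall e, e \in arcs -> labels e != fset0
}.

Definition incident (V : finType) (v : V) (e : V * V) : bool :=
  (e.1 == v) || (e.2 == v).

(* Antiparallel arcs (u, v) and (v, u) are distinct arcs sharing both
   endpoints, so they too must have disjoint label sets. *)
Definition is_proper (V : finType) (G : temporal_digraph V) : Prop :=
  forall (v : V) (e f : V * V),
    e \in arcs G -> f \in arcs G -> e != f ->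
    incident v e -> incident v f ->
    [disjoint labels G e & labels G f]%fset.

(* Starting the chain at the dummy pair (u, u) only forces the first arc to
   leave u. *)
Definition arc_walk (V : finType) (u v : V) (es : seq (V * V)) : bool :=
  [&& path (fun e f => e.2 == f.1) (u, u) es & last u (unzip2 es) == v].

(* The vertices visited are u followed by the heads of the arcs. *)
Definition temporal_path (V : finType) (G : temporal_digraph V) (u v : V)
    (p : seq ((V * V) * nat)) : bool :=
  [&& 0 < size p,
      all (fun x => (x.1 \in arcs G) && (x.2 \in labels G x.1)) p,
      arc_walk u v (unzip1 p),
      uniq (u :: unzip2 (unzip1 p))
    & sorted leq (unzip2 p)].

(* A static digraph on V is represented by its set of arcs. *)
Definition reachability_graph (V : finType) (G : temporal_digraph V) :
    {set V * V} :=
  [set uv | (uv.1 != uv.2) && `[< exists p, temporal_path G uv.1 uv.2 p >]].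

(* Main.v *)
(** Non-strict temporal paths visit distinct vertices, so they have fewer than
    #|V| arcs.  Blow every time step up into #|V| rounds, each of which offers
    every arc of that step once, at a moment reserved for this arc: the i-th
    arc of a temporal path can then be taken in round i of its time step.
    Conversely, forgetting rounds and moments is monotone, so it maps temporal
    paths back to temporal paths along the same arcs. *)
Require Import Defs.
From mathcomp Require Import all_boot.
From mathcomp Require Import finmap boolp.

Set Implicit Arguments.
Unset Strict Implicit.
Unset Printing Implicit Defensive.

Section Spread.
Variables (V : finType) (G : temporal_digraph V).
Implicit Types (e f : V * V) (p : seq ((V * V) * nat)).

(** A mixed-radix numeral with digits [t], [i] and the rank of [e]: the last digit identifies the
    arc, the leading one the original label. *)
Definition moment e t i : nat := (t * #|V| + i) * #|{: V * V}| + enum_rank e.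

Lemma moment_mod e t i : moment e t i %% #|{: V * V}| = enum_rank e.
Proof. by rewrite modnMDl modn_small. Qed.

(** The divisions strip the rank, then the round; [i < #|V|] prevents a carry into [t]. *)
Lemma moment_div e t i :
  i < #|V| -> moment e t i %/ #|{: V * V}| %/ #|V| = t.
Proof.
move=> ltiV; have V0 : 0 < #|V| by apply: leq_ltn_trans ltiV.
have VV0 : 0 < #|{: V * V}| by apply/card_gt0P; exists e.
by rewrite divnMDl // (divn_small (ltn_ord _)) addn0 divnMDl // divn_small ?addn0.
Qed.

(** Ranks are smaller than the length of a round, so moving to the next round makes up for [f] being
    ranked before [e], even when [t = t']. *)
Lemma leq_moment e f t t' i : t <= t' -> moment e t i <= moment f t' i.+1.
Proof.
move=> let_t'; apply: (@leq_trans ((t * #|V| + i).+1 * #|{: V * V}|)).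
  by rewrite mulSnr leq_add2l ltnW.
apply: leq_trans (leq_addr _ _); rewrite leq_mul2r addnS ltnS leq_add2r.
by rewrite leq_mul2r let_t' !orbT.
Qed.

Definition spread_labels e : {fset nat} :=
  [fset s in [seq moment e t i | t <- labels G e, i <- iota 0 #|V|]]%fset.

Lemma spread_labelsP e s :
  reflect (exists t i, [/\ t \in labels G e, i < #|V| & s = moment e t i])
          (s \in spread_labels e).
Proof.
rewrite inE /=; apply: (iffP allpairsP) => [[[t i] /= [tl]]|[t [i [tl ltiV ->]]]].
  by rewrite mem_iota => ltiV ->; exists t, i.
by exists (t, i); rewrite mem_iota.
Qed.

Lemma spread_labels_nonempty e : e \in arcs G -> spread_labels e != fset0.
Proof.
move=> /labels_nonempty /fset0Pn[t tl]; apply/fset0Pn; exists (moment e t 0).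
(* Round 0 exists because [e.1] inhabits [V]. *)
by apply/spread_labelsP; exists t, 0; split=> //; apply/card_gt0P; exists e.1.
Qed.

Definition spread : temporal_digraph V :=
  TemporalDigraph (@arcs_loopless V G) spread_labels_nonempty.

(** A common label would have the ranks of both arcs as its residue, and ranks are injective. *)
Lemma spread_proper : is_proper spread.
Proof.
move=> v e f _ _ nef _ _; apply/fdisjointP => s /spread_labelsP[t [i [_ _ ->]]].
apply/negP => /spread_labelsP[t' [i' [_ _ /(congr1 (modn^~ #|{: V * V}|))]]].
by rewrite /= !moment_mod => /ord_inj/enum_rank_inj/eqP; apply/negP.
Qed.

Fixpoint delay i p :=
  if p is x :: p' then (x.1, moment x.1 x.2 i) :: delay i.+1 p' else [::].

Lemma unzip1_delay i p : unzip1 (delay i p) = unzip1 p.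
Proof. by elim: p i => //= x p IHp i; rewrite IHp. Qed.

Lemma sorted_delay i p :
  sorted leq (unzip2 p) -> sorted leq (unzip2 (delay i p)).
Proof.
(* Consecutive arcs lie in consecutive rounds, so [leq_moment] applies to each adjacent pair. *)
case: p => //= x p; elim: p x i => //= y p IHp x i /andP[lexy sp].
by rewrite leq_moment // IHp.
Qed.

Lemma all_delay i p : i + size p <= #|V| ->
  all (fun x => (x.1 \in arcs G) && (x.2 \in labels G x.1)) p ->
  all (fun x => (x.1 \in arcs spread) && (x.2 \in labels spread x.1))
      (delay i p).
Proof.
elim: p i => //= x p IHp i; rewrite addnS => lepV /andP[/andP[-> xl] allp].
rewrite IHp // andbT; apply/spread_labelsP; exists x.2, i; split=> //.
by apply: leq_trans lepV; rewrite ltnS leq_addr.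
Qed.

Lemma temporal_path_delay u v p :
  temporal_path G u v p -> temporal_path spread u v (delay 0 p).
Proof.
case/and5P=> p0 allp walkp uniqp sp; have sz : size (delay 0 p) = size p.
  by rewrite -(size_map fst) -/(unzip1 _) unzip1_delay size_map.
apply/and5P; split; rewrite ?unzip1_delay ?sz ?sorted_delay //.
apply: all_delay => //; rewrite add0n ltnW //.
(* Counting [u], the path visits [(size p).+1] distinct vertices, so the rounds suffice. *)
by have := max_card (mem (u :: unzip2 (unzip1 p)));
  rewrite (card_uniqP uniqp) /= !size_map.
Qed.

Lemma temporal_path_undelay u v p : temporal_path spread u v p ->
  temporal_path G u v
    [seq (x.1, x.2 %/ #|{: V * V}| %/ #|V|) | x <- p].
Proof.
case/and5P=> p0 allp walkp uniqp sp.
set q := map _ p; have q1 : unzip1 q = unzip1 p by rewrite /unzip1 -map_comp.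
apply/and5P; split; rewrite ?q1 ?size_map //.
  rewrite all_map; apply: sub_all allp => -[e s] /= /andP[-> /spread_labelsP].
  by case=> t [i [tl ltiV ->]]; rewrite moment_div.
(* As an image under a monotone map, the decoded times inherit sortedness. *)
have -> : unzip2 q = [seq s %/ #|{: V * V}| %/ #|V| | s <- unzip2 p].
  by rewrite /unzip2 -!map_comp.
by apply: homo_sorted sp => s s' les; rewrite !leq_div2r.
Qed.

Lemma reachability_spread : reachability_graph G = reachability_graph spread.
Proof.
apply/setP => -[u v]; rewrite !inE; congr (_ && _); apply: asbool_equiv_eq.
split=> -[p]; first by move/temporal_path_delay; exists (delay 0 p).
by move/temporal_path_undelay; eexists; eassumption.
Qed.

End Spread.

Theorem theorem17 (V : finType) (G : temporal_digraph V) :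
  exists H : temporal_digraph V,
    is_proper H /\ reachability_graph G = reachability_graph H.
Proof.
exists (spread G); split; [exact: spread_proper | exact: reachability_spread].
Qed.
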